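(* Let $f$ be a spectral density on $\Lambda$ and $\lambda_{1,n}(f)$ the smallest eigenvalue of $T_n(f)$. (a) If $\overline{E_f}=\Gamma_{2\alpha}(\theta_0)$ with $0<\alpha<\pi$, then $\limsup_{n\to\infty}\sqrt[n]{\lambda_{1,n}(f)}\le\sin^2(\alpha/2)$. (b) If $\overline{E_f}=\Gamma_{\alpha,\delta}(\theta_0)$ with $\alpha>0$, $\delta\ge0$, $\alpha+\delta\le\pi$, then $\limsup_{n\to\infty}\sqrt[n]{\lambda_{1,n}(f)}\le\sin(\alpha/2)\sin(\alpha/2+\delta)$.
   Context: $\Lambda=[-\pi,\pi]$. A spectral density is $f\ge0$, $f\in L^1(\Lambda)$, positive on a set of positive measure; $r(t)=\int_\Lambda e^{-it\lambda}f(\lambda)d\lambda$; $T_n(f)=(r(k-j))_{j,k=0,\dots,n}$. $E_f=\{e^{i\lambda}:f(\lambda)>0\}$ with closure $\overline{E_f}$ (the support of $f$ on the unit circle). For $\theta_0\in[-\pi,\pi)$: $\Gamma_{2\alpha}(\theta_0)=\{e^{i\theta}:|\theta-\theta_0|\le\alpha\}$; $\Gamma_{\alpha,\delta}(\theta_0)=\{e^{i\theta}:\delta\le|\theta-\theta_0|\le\delta+\alpha\}$. *)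

(* Defs.v *)
From HB Require Import structures.
From mathcomp Require Import all_boot all_order all_algebra.
From mathcomp Require Import all_classical all_reals all_analysis.
From mathcomp Require Import complex.
Set Implicit Arguments. Unset Strict Implicit. Unset Printing Implicit Defensive.
Import Order.TTheory GRing.Theory Num.Theory.
Import numFieldNormedType.Exports.
Local Open Scope classical_set_scope.
Local Open Scope ring_scope.

Definition Lambda (R : realType) : set R := `[(- pi)%R, pi]%classic.

Definition spectral_density (R : realType) (f : R -> R) : Prop :=
  (forall x, x \in (@Lambda R) -> 0 <= f x) /\
  (lebesgue_measure).-integrable ((@Lambda R)) (EFin \o f) /\
  (0 < lebesgue_measure ((@Lambda R) `&` [set x | (0 < f x)%R]))%E.

(* covariance r(t) = \int_Lambda e^{-i t l} f(l) dl
                   = \int cos(t l) f(l) dl - i \int sin(t l) f(l) dl *)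
Definition cov (R : realType) (f : R -> R) (t : R) : R[i] :=
  Complex (Rintegral lebesgue_measure (@Lambda R) (fun l => cos (t * l) * f l))
    (- Rintegral lebesgue_measure ((@Lambda R)) (fun l => sin (t * l) * f l)).

Definition toeplitz (R : realType) (f : R -> R) (n : nat) : 'M[R[i]]_n.+1 :=
  \matrix_(j < n.+1, k < n.+1) cov f ((k%:Z - j%:Z)%:~R).

(* smallest eigenvalue of the Hermitian matrix T_n(f) (all its eigenvalues
   are real): the infimum (= minimum) of its real eigenvalues *)
Definition lambda1 (R : realType) (f : R -> R) (n : nat) : R :=
  inf [set a : R | eigenvalue (toeplitz f n) (a%:C)%C].

(* E_f as a subset of the unit circle, points e^{i l} encoded as (cos l, sin l) *)
Definition E_f (R : realType) (f : R -> R) : set (R * R) :=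
  [set (cos l, sin l) | l in [set l | l \in (@Lambda R) /\ 0 < f l]].

Definition Gamma2 (R : realType) (alpha theta0 : R) : set (R * R) :=
  [set (cos t, sin t) | t in [set t | `|t - theta0| <= alpha]].

Definition Gamma_ad (R : realType) (alpha delta theta0 : R) : set (R * R) :=
  [set (cos t, sin t) | t in [set t | delta <= `|t - theta0| <= delta + alpha]].

Definition root_seq (R : realType) (f : R -> R) (n : nat) : \bar R :=
  ((lambda1 f n) `^ (n%:R)^-1)%:E.

(* Main.v *)
(* By Rayleigh's principle, lambda_{1,n}(f) is at most
   \int |p(e^{ix})|^2 f(x) dx / (sum of |coefficients of p|^2) for every nonzero
   polynomial p of degree at most n.  The cosine of the angle measured from theta0
   maps the two arcs onto [cos (alpha + delta), cos delta], an interval of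
   half-length h = sin (alpha/2) sin (alpha/2 + delta).  The Chebyshev polynomial
   T_m of that interval, evaluated at this cosine and multiplied by z^m, is a
   polynomial of degree 2m in z, bounded by 1 on the arcs, whose leading
   coefficient has modulus h^{-m} / 2.  Hence
   lambda_{1,n}(f) <= 4 h^{2m} \int f for n >= 2m >= 2.
   Part (a) is the case delta = 0 of part (b). *)

Require Import Defs.
From HB Require Import structures.
From mathcomp Require Import all_boot all_order all_algebra.
From mathcomp Require Import all_classical all_reals all_analysis.
From mathcomp Require Import measurable_realfun complex.
From mathcomp Require Import ring lra zify.
Set Implicit Arguments.
Unset Strict Implicit.
Unset Printing Implicit Defensive.
Import Order.TTheory GRing.Theory Num.Theory.
Import numFieldNormedType.Exports.
Local Open Scope classical_set_scope.
Local Open Scope ring_scope.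
Local Open Scope sesquilinear_scope.

(** * Rayleigh's principle for Hermitian matrices *)

Lemma sqnorm_rowE (C : numClosedFieldType) n (w : 'rV[C]_n) :
  (w *m w ^t*) 0 0 = \sum_i `|w 0 i| ^+ 2.
Proof. by rewrite !mxE; apply: eq_bigr => i _; rewrite !mxE normCK. Qed.

(** Row [i] of the unitary diagonalizing matrix is an eigenvector, nonzero because that matrix is
    invertible. *)
Lemma eigenvalue_spectral_diag (C : numClosedFieldType) n (A : 'M[C]_n) i :
  A \is normalmx -> eigenvalue A (spectral_diag A 0 i).
Proof.
move=> /orthomx_spectralP; set P := spectralmx A; set d := spectral_diag A => AE.
have Pu : P \in unitmx by exact: spectral_unit.
apply/eigenvalueP; exists (delta_mx 0 i *m P).
  rewrite {1}AE !mulmxA mulmxK// scalemxAl; congr (_ *m _); apply/rowP => j.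
  rewrite mul_mx_diag !mxE /=.
  by case: eqVneq => [->|_]; rewrite ?mul1r ?mulr1 ?mul0r ?mulr0.
apply/eqP => /(congr1 (mulmx^~ (invmx P))); rewrite mulmxK// mul0mx.
by move=> /rowP /(_ i); rewrite !mxE !eqxx => /eqP; rewrite oner_eq0.
Qed.

(** The entries of [w] are the coordinates of [v] in an orthonormal eigenbasis, where the form is
    diagonal. *)
Lemma hermitian_form_spectralE (C : numClosedFieldType) n (A : 'M[C]_n)
    (v : 'rV[C]_n) (w := v *m invmx (spectralmx A)) : A \is normalmx ->
  (v *m A *m v ^t*) 0 0 = \sum_i spectral_diag A 0 i * `|w 0 i| ^+ 2.
Proof.
move=> /orthomx_spectralP; set P := spectralmx A in w *.
set d := spectral_diag A => AE.
have PU : P \is unitarymx by exact: spectral_unitarymx.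
have -> : v *m A *m v ^t* = (w *m diag_mx d) *m w ^t*.
  rewrite {1}AE /w [in RHS]trmx_mul map_mxM/= [in RHS]invmx_unitary//.
  by rewrite trmxCK -invmx_unitary// !mulmxA.
by rewrite mxE; apply: eq_bigr => i _; rewrite mul_mx_diag !mxE normCK; ring.
Qed.

Lemma sqnorm_spectral (C : numClosedFieldType) n (A : 'M[C]_n)
    (v : 'rV[C]_n) (w := v *m invmx (spectralmx A)) :
  (v *m v ^t*) 0 0 = (w *m w ^t*) 0 0.
Proof.
rewrite /w invmx_unitary ?spectral_unitarymx// trmx_mul map_mxM/= trmxCK.
by rewrite !mulmxA mulmxKtV// spectral_unitarymx.
Qed.

(** The witness is the least eigenvalue: in the eigenbasis both sides are weighted sums of the same
    squared moduli and compare termwise. *)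
Lemma rayleigh_eigenvalue (R : realType) n (A : 'M[R[i]]_n.+1)
    (v : 'rV[R[i]]_n.+1) : A \is hermsymmx ->
  exists2 a : R, eigenvalue A (a%:C)%C &
    (a%:C)%C * (v *m v ^t*) 0 0 <= (v *m A *m v ^t*) 0 0.
Proof.
move=> Ah; have An := hermitian_normalmx Ah.
set d := spectral_diag A.
have dR i : (complex.Re (d 0 i))%:C%C = d 0 i.
  by apply/RRe_real; have /mxOverP -> := hermitian_spectral_diag_real Ah.
(* The order on [R[i]] is partial, so the minimum is taken over real parts; by [dR] these are the
   entries themselves. *)
case: (arg_minP (P := predT) (fun i => complex.Re (d 0 i)) (i0 := ord0)) => // i _ imin.
exists (complex.Re (d 0 i)); first by rewrite dR; exact: eigenvalue_spectral_diag.
rewrite (@sqnorm_spectral _ _ A) sqnorm_rowE hermitian_form_spectralE// mulr_sumr.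
apply: ler_sum => j _; rewrite ler_wpM2r ?exprn_ge0// -[leRHS]dR lecR.
exact: imin.
Qed.

(** At an eigenvector the form equals [a] times a positive squared norm. This bounds the set of
    eigenvalues from below, so that its infimum is meaningful. *)
Lemma hermitian_eigenvalue_ge0 (R : realType) n (A : 'M[R[i]]_n) (a : R) :
  (forall v : 'rV[R[i]]_n, 0 <= (v *m A *m v ^t*) 0 0) ->
  eigenvalue A (a%:C)%C -> 0 <= a.
Proof.
move=> A_ge0 /eigenvalueP[v vA v0]; have := A_ge0 v.
rewrite vA -scalemxAl mxE sqnorm_rowE pmulr_lge0 ?ler0c//.
rewrite lt_neqAle sumr_ge0 ?andbT => [|i _]; last exact: exprn_ge0.
apply: contra v0; rewrite eq_sym psumr_eq0 => [/allP v0|i _]; last exact: exprn_ge0.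
apply/eqP/rowP => i; rewrite mxE; apply/eqP.
by have := v0 i (mem_index_enum _); rewrite sqrf_eq0 normr_eq0.
Qed.

(** * Points of the unit circle *)

Definition expi {R : realType} (x : R) : R[i] := (cos x +i* sin x)%C.

Lemma expiD (R : realType) (x y : R) : expi (x + y) = expi x * expi y.
Proof. by rewrite /expi cosD sinD; congr Complex; rewrite addrC mulrC [X in _ + X]mulrC. Qed.

Lemma expiX (R : realType) (x : R) n : expi x ^+ n = expi (n%:R * x).
Proof.
elim: n => [|n IHn]; first by rewrite expr0 mul0r /expi cos0 sin0.
by rewrite exprS IHn -expiD -[in RHS]natr1 mulrDl mul1r addrC.
Qed.

Lemma conj_expi (R : realType) (x : R) : (expi x)^* = expi (- x).
Proof. by rewrite /expi cosN sinN. Qed.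

Lemma norm_expi (R : realType) (x : R) : `|expi x| = 1.
Proof. by rewrite normc_def /= cos2Dsin2 Num.Theory.sqrtr1. Qed.

(** * Complex-valued integrals, taken componentwise, and their linearity over [R[i]] *)

Section complex_integral.
Context {d} {T : measurableType d} {R : realType} (mu : {measure set T -> \bar R}).
Variables (D : set T) (mD : measurable D).

Definition cintegrable (F : T -> R[i]) :=
  mu.-integrable D (EFin \o (fun x => complex.Re (F x))) /\
  mu.-integrable D (EFin \o (fun x => complex.Im (F x))).

Definition cintegral (F : T -> R[i]) : R[i] :=
  (Rintegral mu D (fun x => complex.Re (F x)) +i*
   Rintegral mu D (fun x => complex.Im (F x)))%C.

Lemma cintegrable0 : cintegrable (fun=> 0).
Proof. by split; exact: integrable0. Qed.

Lemma cintegral0 : cintegral (fun=> 0) = 0.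
Proof. by rewrite /cintegral/= !Rintegral_cst// mul0r. Qed.

Lemma cintegrableD F G : cintegrable F -> cintegrable G ->
  cintegrable (fun x => F x + G x).
Proof.
move=> [F1 F2] [G1 G2]; split.
  apply: eq_integrable (integrableD mD F1 G1) => // x _ /=.
  by case: (F x) (G x) => ? ? [].
apply: eq_integrable (integrableD mD F2 G2) => // x _ /=.
by case: (F x) (G x) => ? ? [].
Qed.

Lemma cintegralD F G : cintegrable F -> cintegrable G ->
  cintegral (fun x => F x + G x) = cintegral F + cintegral G.
Proof.
move=> [F1 F2] [G1 G2]; rewrite /cintegral; congr Complex; rewrite -RintegralD//.
  by apply: eq_Rintegral => x _; case: (F x) (G x) => ? ? [].
by apply: eq_Rintegral => x _; case: (F x) (G x) => ? ? [].
Qed.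

Lemma cintegrableZ c F : cintegrable F -> cintegrable (fun x => c * F x).
Proof.
case: c => a b [F1 F2]; split.
  apply: eq_integrable (integrableB mD (integrableZl mD a F1) (integrableZl mD b F2)) => // x _ /=.
  by case: (F x).
apply: eq_integrable (integrableD mD (integrableZl mD a F2) (integrableZl mD b F1)) => // x _ /=.
by case: (F x).
Qed.

Lemma cintegralZ c F : cintegrable F ->
  cintegral (fun x => c * F x) = c * cintegral F.
Proof.
case: c => a b [F1 F2].
have Z r (g : T -> R) : mu.-integrable D (EFin \o g) ->
  mu.-integrable D (EFin \o (fun x => r * g x)) by move=> ig; exact: (integrableZl mD r ig).
rewrite /cintegral; congr Complex; rewrite -!RintegralZl//.
  by rewrite -RintegralB; [|by []|exact: Z..]; apply: eq_Rintegral => x _; case: (F x).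
by rewrite -RintegralD; [|by []|exact: Z..]; apply: eq_Rintegral => x _; case: (F x).
Qed.

Lemma cintegrable_sum I (r : seq I) (F : I -> T -> R[i]) :
  (forall i, cintegrable (F i)) -> cintegrable (fun x => \sum_(i <- r) F i x).
Proof.
move=> iF; elim: r => [|i r IHr].
  by under eq_fun do rewrite big_nil; exact: cintegrable0.
by under eq_fun do rewrite big_cons; exact: cintegrableD.
Qed.

Lemma cintegral_sum I (r : seq I) (F : I -> T -> R[i]) :
  (forall i, cintegrable (F i)) ->
  cintegral (fun x => \sum_(i <- r) F i x) = \sum_(i <- r) cintegral (F i).
Proof.
move=> iF; elim: r => [|i r IHr].
  by under eq_fun do rewrite big_nil; rewrite big_nil cintegral0.
under eq_fun do rewrite big_cons.
by rewrite cintegralD// ?IHr ?big_cons//; exact: cintegrable_sum.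
Qed.

End complex_integral.

(** * The Toeplitz form as an integral against [f] *)

Section toeplitz_form.
Context {R : realType}.
Variables (f : R -> R).
Hypothesis fint : lebesgue_measure.-integrable (@Lambda R) (EFin \o f).

Let mL : measurable (@Lambda R : set (measurableTypeR R)). Proof. exact: measurable_itv. Qed.

Lemma cintegrable_expi (t : R) :
  cintegrable lebesgue_measure (@Lambda R) (fun x => expi (t * x) * (f x)%:C%C).
Proof.
have bcos : [bounded cos (t * x) | x in @Lambda R].
  by exists 1; split=> // M M1 x _; rewrite /= (le_trans (cos_max _))// ltW.
have bsin : [bounded sin (t * x) | x in @Lambda R].
  by exists 1; split=> // M M1 x _; rewrite /= (le_trans (sin_max _))// ltW.
have mcos : measurable_fun (@Lambda R) (fun x : measurableTypeR R => cos (t * x)).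
  apply: measurable_funTS; apply: continuous_measurable_fun => x.
  by apply: continuous_comp; [exact: mulrl_continuous|exact: continuous_cos].
have msin : measurable_fun (@Lambda R) (fun x : measurableTypeR R => sin (t * x)).
  apply: measurable_funTS; apply: continuous_measurable_fun => x.
  by apply: continuous_comp; [exact: mulrl_continuous|exact: continuous_sin].
split.
  apply: eq_integrable (integrableMr mL mcos bcos fint) => // x _ /=.
  by rewrite mulr0 subr0.
apply: eq_integrable (integrableMr mL msin bsin fint) => // x _ /=.
by rewrite mulr0 add0r.
Qed.

Lemma covE (t : R) :
  cov f t = cintegral lebesgue_measure (@Lambda R)
              (fun x => expi (- t * x) * (f x)%:C%C).
Proof.
rewrite /cov /cintegral; congr Complex.
  by apply: eq_Rintegral => x _ /=; rewrite mulr0 subr0 mulNr cosN.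
rewrite -mulN1r -RintegralZl//.
  by apply: eq_Rintegral => x _ /=; rewrite mulr0 add0r mulN1r mulNr sinN mulNr.
have [_] := cintegrable_expi t.
by apply: eq_integrable => // x _ /=; rewrite mulr0 add0r.
Qed.

Lemma conj_cov (t : R) : (cov f t)^* = cov f (- t).
Proof.
rewrite /cov /=; congr Complex.
  by apply: eq_Rintegral => x _; rewrite mulNr cosN.
rewrite opprK -mulN1r -RintegralZl//.
  by apply: eq_Rintegral => x _ /=; rewrite mulN1r mulNr sinN mulNr opprK.
have [_] := cintegrable_expi (- t).
by apply: eq_integrable => // x _ /=; rewrite mulr0 add0r.
Qed.

Lemma toeplitz_hermsym n : toeplitz f n \is hermsymmx.
Proof.
apply/is_hermitianmxP; rewrite expr0 scale1r; apply/matrixP => j k.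
by rewrite !mxE conj_cov -mulrNz opprB.
Qed.

(** This is [|p(e^{ix})|^2 f(x)], with [p] the polynomial of coefficients [v], expanded into a
    double sum so that each term integrates to an entry of the Toeplitz matrix. *)
Let form n (v : 'rV[R[i]]_n.+1) (x : R) :=
  \sum_k \sum_j (v 0 j * (v 0 k)^*) * (expi (- (k%:Z - j%:Z)%:~R * x) * (f x)%:C%C).

Let formE n (v : 'rV[R[i]]_n.+1) :
  form v = fun x => (complex.Re (`|\sum_j v 0 j * expi x ^+ j| ^+ 2) * f x)%:C%C.
Proof.
apply/funext => x.
rewrite [RHS]rmorphM [X in _ = X * _]RRe_real ?rpredX ?normr_real//.
rewrite normCK rmorph_sum mulr_sumr mulr_suml.
apply: eq_bigr => k _; rewrite mulr_suml mulr_suml; apply: eq_bigr => j _.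
rewrite rmorphM /= !expiX conj_expi.
have -> : - (k%:Z - j%:Z)%:~R * x = j%:R * x + - (k%:R * x).
  by rewrite rmorphB /=; ring.
by rewrite expiD; ring.
Qed.

Let cintegrable_form1 n (v : 'rV[R[i]]_n.+1) (k j : 'I_n.+1) :
  cintegrable lebesgue_measure (@Lambda R) (fun x =>
    (v 0 j * (v 0 k)^*) * (expi (- (k%:Z - j%:Z)%:~R * x) * (f x)%:C%C)).
Proof. by apply: cintegrableZ => //; exact: cintegrable_expi. Qed.

Lemma integrable_sqnorm_trigpoly n (v : 'rV[R[i]]_n.+1) :
  lebesgue_measure.-integrable (@Lambda R)
    (EFin \o (fun x => complex.Re (`|\sum_j v 0 j * expi x ^+ j| ^+ 2) * f x)).
Proof.
have : cintegrable lebesgue_measure (@Lambda R) (form v).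
  by apply: cintegrable_sum => // k; apply: cintegrable_sum => // j.
by rewrite formE => -[].
Qed.

Lemma toeplitz_formE n (v : 'rV[R[i]]_n.+1) :
  (v *m toeplitz f n *m v ^t*) 0 0 =
  (Rintegral lebesgue_measure (@Lambda R)
     (fun x => complex.Re (`|\sum_j v 0 j * expi x ^+ j| ^+ 2) * f x))%:C%C.
Proof.
have -> : (v *m toeplitz f n *m v ^t*) 0 0 =
    \sum_k \sum_j (v 0 j * (v 0 k)^*) * cov f ((k%:Z - j%:Z)%:~R).
  rewrite mxE; apply: eq_bigr => k _; rewrite !mxE mulr_suml.
  by apply: eq_bigr => j _; rewrite !mxE; ring.
transitivity (cintegral lebesgue_measure (@Lambda R) (form v)).
  rewrite cintegral_sum// => [|k]; last by apply: cintegrable_sum.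
  apply: eq_bigr => k _; rewrite cintegral_sum//.
  apply: eq_bigr => j _; rewrite covE cintegralZ//; exact: cintegrable_expi.
(* The integrand is real, so the imaginary part is the integral of 0. *)
by rewrite formE /cintegral /=; congr Complex; rewrite Rintegral_cst// mul0r.
Qed.

Lemma toeplitz_form_ge0 n (v : 'rV[R[i]]_n.+1) :
  (forall x, x \in @Lambda R -> 0 <= f x) ->
  0 <= (v *m toeplitz f n *m v ^t*) 0 0.
Proof.
move=> f0; rewrite toeplitz_formE ler0c; apply: Rintegral_ge0 => x Lx.
rewrite mulr_ge0 ?f0 ?inE//.
have := exprn_ge0 2 (normr_ge0 (\sum_j v 0 j * expi x ^+ j)).
by rewrite lecE => /andP[].
Qed.

End toeplitz_form.

(** * Chebyshev polynomials transplanted to the arcs *)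

Lemma size_mul_leqS (S : nzRingType) (p q : {poly S}) a b :
  (size p <= a -> size q <= b.+1 -> size (p * q)%R <= a + b)%N.
Proof.
move=> pa qb; rewrite (leq_trans (size_polyMleq _ _))//.
by rewrite -subn1 leq_subLR add1n -addnS leq_add.
Qed.

Section chebyshev.
Context {R : realType}.
Variables (w : R[i]) (c h : R).

(* With [z = w * 'X] of modulus 1 and [u = (Re z - c) / h], these are the
   polynomials [z ^+ m * T_m(u)], [T_m] being the Chebyshev polynomials. *)
Let A : {poly R[i]} :=
  (w ^+ 2 / (2 * h%:C%C)) *: 'X^2 - (c%:C%C * w / h%:C%C) *: 'X + (2 * h%:C%C)^-1%:P.

(** [A] represents [z * u]. The recurrence [T_{m+2} = 2 u T_{m+1} - T_m], multiplied by [z^{m+2}],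
    gives the second component; carrying consecutive terms as a pair makes the recursion
    structural. *)
Fixpoint cheb2 (m : nat) : {poly R[i]} * {poly R[i]} :=
  if m is m'.+1 then
    let: (p, q) := cheb2 m' in (q, 2 *: (A * q) - w ^+ 2 *: ('X^2 * p))
  else (1, A).

Definition arc_cheb m := (cheb2 m).1.

Lemma arc_chebSS m :
  arc_cheb m.+2 = 2 *: (A * arc_cheb m.+1) - w ^+ 2 *: ('X^2 * arc_cheb m).
Proof. by rewrite /arc_cheb /=; case: (cheb2 m). Qed.

Lemma size_A : (size A <= 3)%N.
Proof.
rewrite (leq_trans (size_polyD _ _))// geq_max (leq_trans (size_polyC_leq1 _))// andbT.
rewrite (leq_trans (size_polyD _ _))// geq_max size_polyN.
by rewrite !(leq_trans (size_scale_leq _ _))// ?size_polyX ?size_polyXn.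
Qed.

Lemma size_arc_cheb m : (size (arc_cheb m) <= (m.*2).+1)%N.
Proof.
suff : (size (arc_cheb m) <= (m.*2).+1)%N && (size (arc_cheb m.+1) <= (m.+1.*2).+1)%N.
  by case/andP.
elim: m => [|m /andP[IH0 IH1]]; first by rewrite size_poly1 size_A.
rewrite IH1/= arc_chebSS (leq_trans (size_polyD _ _))// geq_max size_polyN.
rewrite !(leq_trans (size_scale_leq _ _))//.
  have sX : (size ('X^2 : {poly R[i]}) <= 3)%N by rewrite size_polyXn.
  by apply: leq_trans (size_mul_leqS sX IH0) _; lia.
by apply: leq_trans (size_mul_leqS size_A IH1) _; lia.
Qed.

(** Each step multiplies the leading coefficient by [2 * A_2 = w^2 / h]. The formula starts at index
    1 because the step from 0 to 1 lacks the factor 2. *)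
Lemma coef_arc_cheb m : h != 0 ->
  (arc_cheb m.+1)`_(m.+1.*2) = w ^+ m.+1.*2 / (2 * h%:C%C ^+ m.+1).
Proof.
move=> h0; have hC : h%:C%C != 0 :> R[i] by rewrite eq_complex /= eqxx andbT.
have A2 : A`_2 = w ^+ 2 / (2 * h%:C%C).
  by rewrite /A !(coefD, coefN, coefZ, coefXn, coefX, coefC)/= mulr1 mulr0 subr0 addr0.
elim: m => [|m IHm]; first by rewrite [arc_cheb 1]/= A2 expr1.
have E2 : (m.+2.*2 = 2 + m.+1.*2)%N by lia.
rewrite arc_chebSS E2 coefB !coefZ coefXnM ltnNge leq_addr /= addKn.
rewrite [(arc_cheb m)`__]nth_default ?mulr0 ?subr0; last first.
  by rewrite (leq_trans (size_arc_cheb _))// ltn_double.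
(* Only index 2 survives in the convolution: below it the second factor is past its degree, above it
   [A] is. *)
have -> : (A * arc_cheb m.+1)`_(2 + m.+1.*2) = A`_2 * (arc_cheb m.+1)`_(m.+1.*2).
  rewrite coefM (bigD1 (inord 2)) //=.
  rewrite [X in _ * _`_X](_ : _ = m.+1.*2)%N; last by rewrite inordK//; lia.
  rewrite inordK; last by lia.
  rewrite big1 ?addr0// => i ne_i2.
  have {}ne_i2 : (i != 2 :> nat).
    by apply: contra ne_i2 => /eqP i2; apply/eqP/val_inj; rewrite /= inordK.
  have [i_lt|i_gt] := ltnP i 2.
    by rewrite [(arc_cheb _)`__]nth_default ?mulr0// (leq_trans (size_arc_cheb _))//; lia.
  by rewrite [A`__]nth_default ?mul0r// (leq_trans size_A)//; lia.
rewrite IHm A2 exprD [h%:C%C ^+ m.+2]exprS; field.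
by rewrite expf_eq0 (negPf hC) /=.
Qed.

End chebyshev.

(** Here [u = cos t], and [T_m (cos t) = cos (m t)]. *)
Lemma horner_arc_cheb (R : realType) (s c h x t : R) m : h != 0 ->
  cos (x + s) = c + h * cos t ->
  (arc_cheb (expi s) c h m).[expi x] = expi (x + s) ^+ m * (cos (m%:R * t))%:C%C.
Proof.
move=> h0 xs; have hC : h%:C%C != 0 :> R[i] by rewrite eq_complex /= eqxx andbT.
set z := expi (x + s); pose P := arc_cheb (expi s) c h.
have zE : z = expi s * expi x by rewrite /z addrC expiD.
(* For [|z| = 1], [z^2 + 1 = 2 z Re z]; this identifies the value of [A] with [z * u]. *)
have z2 : z ^+ 2 + 1 = 2 * z * (c + h * cos t)%:C%C.
  rewrite -xs /z /expi; apply/eqP; rewrite eq_complex /=.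
  by have := cos2Dsin2 (x + s) => cs; apply/andP; split; apply/eqP; nra.
have P1 : (P 1).[expi x] = z * (cos t)%:C%C.
  rewrite /P /arc_cheb /= !(hornerD, hornerN, hornerZ, hornerXn, hornerX, hornerC).
  have -> : expi s ^+ 2 / (2 * h%:C%C) * expi x ^+ 2 - c%:C%C * expi s / h%:C%C * expi x +
       (2 * h%:C%C)^-1 = (z ^+ 2 + 1 - 2 * z * c%:C%C) / (2 * h%:C%C).
    by rewrite zE; field.
  by rewrite z2 rmorphD rmorphM /=; field.
suff : (P m).[expi x] = z ^+ m * (cos (m%:R * t))%:C%C /\
   (P m.+1).[expi x] = z ^+ m.+1 * (cos (m.+1%:R * t))%:C%C by case.
elim: m => [|m [IH0 IH1]].
  by rewrite mul0r cos0 mulr1 expr0 hornerC mul1r expr1; split.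
split=> //; rewrite /P arc_chebSS hornerD hornerN !hornerZ 2!hornerM hornerXn.
rewrite -/(P m) -/(P m.+1) IH0 IH1 -[X in X * (z ^+ m.+1 * _)]/((P 1).[expi x]) P1.
have -> : cos (m.+2%:R * t) = 2 * cos t * cos (m.+1%:R * t) - cos (m%:R * t).
  have -> : m.+2%:R * t = m.+1%:R * t + t by rewrite -natr1; ring.
  have -> : m%:R * t = m.+1%:R * t - t by rewrite -[m.+1%:R]natr1; ring.
  by rewrite cosD cosB; ring.
by rewrite rmorphB !rmorphM /= rmorph_nat zE !exprMn !exprS; ring.
Qed.

(** The hypothesis puts [u] in [[-1, 1]], so it is the cosine of a real angle and the value is a
    unit times a cosine. *)
Lemma normr_horner_arc_cheb_le1 (R : realType) (s c h x : R) m : 0 < h ->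
  c - h <= cos (x + s) <= c + h -> `|(arc_cheb (expi s) c h m).[expi x]| <= 1.
Proof.
move=> h0 /andP[xl xu]; pose u := (cos (x + s) - c) / h.
have u1 : -1 <= u <= 1.
  by rewrite /u ler_pdivlMr// ler_pdivrMr//; lra.
have xE : cos (x + s) = c + h * cos (acos u).
  by rewrite acosK// /u; field; rewrite gt_eqF.
rewrite (horner_arc_cheb m _ xE) ?gt_eqF// normrM normrX norm_expi expr1n mul1r.
rewrite normc_def /= expr0n addr0 sqrtr_sqr.
by rewrite lecR cos_max.
Qed.

(** * Bounds on the smallest eigenvalue *)

Lemma lambda1_ge0 (R : realType) (f : R -> R) n :
  spectral_density f -> 0 <= lambda1 f n.
Proof.
move=> [f0 [fint _]]; rewrite /lambda1.
(* The vector [0] serves only to produce some eigenvalue, making the set nonempty. *)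
have [a ea _] := rayleigh_eigenvalue 0 (toeplitz_hermsym fint n).
apply: lb_le_inf; first by exists a.
by move=> b; apply: hermitian_eigenvalue_ge0 => v; exact: toeplitz_form_ge0.
Qed.

Lemma lambda1_le_rayleigh (R : realType) (f : R -> R) n (v : 'rV[R[i]]_n.+1) :
  spectral_density f ->
  (lambda1 f n)%:C%C * (v *m v ^t*) 0 0 <= (v *m toeplitz f n *m v ^t*) 0 0.
Proof.
move=> fsd; have [f0 [fint _]] := fsd.
have [a ea /(le_trans _)] := rayleigh_eigenvalue v (toeplitz_hermsym fint n).
apply; rewrite ler_wpM2r//.
  by rewrite sqnorm_rowE sumr_ge0// => i _; exact: exprn_ge0.
rewrite lecR /lambda1; apply: ge_inf => //; exists 0 => b.
by apply: hermitian_eigenvalue_ge0 => w; exact: toeplitz_form_ge0.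
Qed.

(* The Rayleigh quotient at the coefficients of [p], whose sum of squared moduli
   is at least the square of any single one. *)
Lemma lambda1_le_poly (R : realType) (f : R -> R) n k (p : {poly R[i]}) (b : R) :
  spectral_density f -> (size p <= n.+1)%N -> (k <= n)%N ->
  (forall x, x \in @Lambda R -> 0 < f x -> `|p.[expi x]| <= 1) ->
  0 < b -> b%:C%C <= `|p`_k| ^+ 2 ->
  lambda1 f n * b <= Rintegral lebesgue_measure (@Lambda R) f.
Proof.
move=> fsd pn kn p1 b0 bp; have [f0 [fint _]] := fsd.
pose v : 'rV[R[i]]_n.+1 := \row_j p`_j.
have vE x : \sum_j v 0 j * expi x ^+ j = p.[expi x].
  by rewrite (horner_coef_wide _ pn); apply: eq_bigr => j _; rewrite mxE.
have bv : b%:C%C <= (v *m v ^t*) 0 0.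
  rewrite sqnorm_rowE (bigD1 (Ordinal (kn : (k < n.+1)%N)))//= mxE (le_trans bp)//.
  by rewrite lerDl sumr_ge0// => i _; exact: exprn_ge0.
have : (lambda1 f n * b)%:C%C <= (v *m toeplitz f n *m v ^t*) 0 0.
  apply: le_trans (lambda1_le_rayleigh v fsd).
  by rewrite rmorphM ler_wpM2l// ler0c lambda1_ge0.
rewrite toeplitz_formE// lecR => /le_trans; apply.
apply: le_Rintegral => //.
- exact: measurable_itv.
- exact: integrable_sqnorm_trigpoly.
move=> x Lx; rewrite vE; have xL : x \in @Lambda R by rewrite inE.
(* The bound on [p] is available only where [f] is positive; where [f] vanishes, so does the
   integrand. *)
have := f0 x xL; rewrite le_eqVlt => /predU1P[<-|fx0]; first by rewrite mulr0.
rewrite ler_piMl ?(ltW fx0)//.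
have : `|p.[expi x]| ^+ 2 <= 1 by rewrite exprn_ile1// p1.
by rewrite lecE => /andP[].
Qed.

(** * Root asymptotics and the geometry of the arcs *)

Lemma limn_esup_le_root (R : realType) (u : R^nat) (K h : R) :
  0 < K -> 0 < h -> (forall n, 0 <= u n) ->
  (forall n, (1 < n)%N -> u n <= K * h ^+ n) ->
  (limn_esup (fun n => ((u n) `^ (n%:R)^-1)%:E) <= h%:E)%E.
Proof.
move=> K0 h0 u0 uK.
have cvgK : (fun n => (K `^ (n%:R^-1) * h)%:E) @ \oo --> h%:E.
  apply: cvg_EFin; first exact: nearW.
  rewrite -[X in _ --> X]mul1r; apply: cvgMl.
  (* [K^(1/n)] is [exp (ln K / n)], which tends to [exp 0 = 1], so the constant disappears in the
     root. *)
  rewrite /powR gt_eqF//.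
  rewrite [X in _ --> X](_ : 1 = expR (0 * ln K)); last by rewrite mul0r expR0.
  apply: continuous_cvg; first exact: continuous_expR.
  apply: cvgMl; apply/gtr0_cvgV0; last exact: cvgr_idn.
  by near=> n; rewrite ltr0n; near: n; exists 1%N.
have <- : limn_esup (fun n => (K `^ (n%:R^-1) * h)%:E) = h%:E.
  exact: (cvg_limn_einf_sup cvgK).2.
rewrite !limn_esup_lim; apply: lee_lim; [exact: is_cvg_esups..|].
(* Tail suprema are compared termwise from index 2 on, where [uK] applies. *)
near=> n; apply: ub_ereal_sup => _ [m /= nm <-].
apply: le_trans (ereal_sup_ubound _); last by exists m.
rewrite lee_fin.
have m1 : (1 < m)%N by apply: leq_trans nm; near: n; exists 2%N.
apply: le_trans (_ : (K * h ^+ m) `^ (m%:R^-1) <= _).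
  by rewrite ge0_ler_powR ?nnegrE ?uK// mulr_ge0 ?exprn_ge0// ltW.
rewrite powRM ?exprn_ge0 ?(ltW K0) ?(ltW h0)// -powR_mulrn ?(ltW h0)//.
rewrite -powRrM mulfV ?powRr1 ?(ltW h0)//.
by rewrite pnatr_eq0 -lt0n ltnW.
Unshelve. all: by end_near.
Qed.

(** The distance [|t - theta0|] lies in [[0, pi]], where cosine decreases. *)
Lemma arc_cos_range (R : realType) (theta0 alpha delta x : R) :
  0 <= delta -> alpha + delta <= pi ->
  Gamma_ad alpha delta theta0 (cos x, sin x) ->
  cos (alpha + delta) <= cos (x - theta0) <= cos delta.
Proof.
move=> d0 adpi [t /= /andP[dt ta] [ct st]].
(* The angles [x] and [t] may differ by a multiple of [2 pi]; only their cosines and sines agree. *)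
have -> : cos (x - theta0) = cos `|t - theta0|.
  by rewrite cos_norm !cosB ct st.
have t0 := normr_ge0 (t - theta0).
have pi0 := pi_ge0 R.
apply/andP; split; rewrite leNgt ltr_cos -?leNgt ?in_itv /=; lra.
Qed.

Lemma limn_esup_root_seq_arcs (R : realType) (f : R -> R) (theta0 alpha delta : R) :
  spectral_density f -> 0 < alpha -> 0 <= delta -> alpha + delta <= pi ->
  closure (E_f f) = Gamma_ad alpha delta theta0 ->
  (limn_esup (root_seq f) <= (sin (alpha / 2) * sin (alpha / 2 + delta))%:E)%E.
Proof.
move=> fsd a0 d0 adpi Ef.
set h := sin (alpha / 2) * sin (alpha / 2 + delta).
(* [c] and [h] are the midpoint and half-length of [[cos (alpha + delta), cos delta]]. *)
pose c := (cos delta + cos (alpha + delta)) / 2.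
have h0 : 0 < h by apply: mulr_gt0; apply: sin_gt0_pi; apply/andP; split; lra.
have [ch1 ch2] : c - h = cos (alpha + delta) /\ c + h = cos delta.
  have -> : h = (cos delta - cos (alpha + delta)) / 2.
    have -> : cos delta = cos ((alpha / 2 + delta) - alpha / 2) by congr cos; lra.
    have -> : cos (alpha + delta) = cos ((alpha / 2 + delta) + alpha / 2) by congr cos; lra.
    by rewrite cosB [cos (_ + _ + _)]cosD /h; field.
  by rewrite /c; split; lra.
have h1 : h <= 1.
  by have := cos_le1 delta; have := cos_geN1 (alpha + delta); lra.
clearbody h; pose I := Rintegral lebesgue_measure (@Lambda R) f.
have I0 : 0 <= I.
  by apply: Rintegral_ge0 => x Lx; apply: fsd.1; rewrite inE.
(* The 4 is the square of the 2 in the leading coefficient; [I + 1] in place of [I] makes the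
   constant positive, as the root lemma requires. *)
have le1 m n : (m.+1.*2 <= n)%N -> lambda1 f n <= 4 * (I + 1) * h ^+ m.+1.*2.
  move=> mn; have hm : 0 < h ^+ m.+1.*2 by rewrite exprn_gt0.
  have h4 : 0 < 4 * h ^+ m.+1.*2 by apply: mulr_gt0.
  have := @lambda1_le_poly R f n m.+1.*2 (arc_cheb (expi (- theta0)) c h m.+1)
    ((4 * h ^+ m.+1.*2)^-1) fsd.
  have -> : `|(arc_cheb (expi (- theta0)) c h m.+1)`_(m.+1.*2)| ^+ 2 = ((4 * h ^+ m.+1.*2)^-1)%:C%C.
    rewrite coef_arc_cheb ?gt_eqF// normf_div normrX norm_expi expr1n.
    rewrite normrM normrX normr_nat normc_def/= expr0n addr0 sqrtr_sqr gtr0_norm//.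
    rewrite expr_div_n expr1n exprMn -exprM muln2 fmorphV.
    by rewrite rmorphM rmorphXn rmorph_nat mul1r; congr (_ * _)^-1; ring.
  move=> /(_ _ mn _ _ (lexx _)); rewrite -/I => H.
  have : lambda1 f n / (4 * h ^+ m.+1.*2) <= I.
    apply: H.
    - by rewrite (leq_trans (size_arc_cheb _ _ _ _))// ltnS.
    - move=> x xL fx; apply: normr_horner_arc_cheb_le1 => //.
      rewrite ch1 ch2; apply: arc_cos_range => //.
      rewrite -Ef; apply: subset_closure; exists x => //.
    - by rewrite invr_gt0.
  rewrite ler_pdivrMr// => /le_trans; apply.
  by rewrite -mulrA [leRHS]mulrCA ler_wpM2r ?(ltW h4)// lerDl.
(* Rounding [n] down to an even degree costs at most one factor [h], since [h <= 1]; dividing the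
   constant by [h] absorbs it. *)
have := @limn_esup_le_root R (lambda1 f) (4 * (I + 1) / h) h.
apply => //.
- by rewrite divr_gt0// mulr_gt0// ltr_pwDr.
- by move=> n; exact: lambda1_ge0.
- case=> [//|[//|n] _].
  have nE : (n./2.+1.*2 <= n.+2)%N by have := odd_double_half n; lia.
  apply: le_trans (le1 _ _ nE) _; rewrite -[leRHS]mulrA ler_wpM2l//.
    by rewrite mulr_ge0// addr_ge0.
  rewrite exprS mulKf ?gt_eqF//; apply: ler_wiXn2l; rewrite ?(ltW h0)//.
  by have := odd_double_half n; case: (odd n) => /=; lia.
Qed.

Theorem mainTheorem18 (R : realType) (f : R -> R) (theta0 : R) :
  spectral_density f ->
  (- pi <= theta0 < pi) ->
  (forall alpha : R, 0 < alpha < pi ->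
     closure (E_f f) = Gamma2 alpha theta0 ->
     (limn_esup (root_seq f) <= ((sin (alpha / 2)) ^+ 2)%:E)%E) /\
  (forall alpha delta : R, 0 < alpha -> 0 <= delta -> alpha + delta <= pi ->
     closure (E_f f) = Gamma_ad alpha delta theta0 ->
     (limn_esup (root_seq f) <= (sin (alpha / 2) * sin (alpha / 2 + delta))%:E)%E).
Proof.
move=> fsd _; split=> [alpha /andP[a0 api] Ef|alpha delta a0 d0 adpi Ef]; last first.
  exact: limn_esup_root_seq_arcs Ef.
rewrite expr2 -[X in sin _ * sin X]addr0.
apply: (@limn_esup_root_seq_arcs _ _ theta0) => //; first by rewrite addr0 ltW.
rewrite Ef /Gamma2 /Gamma_ad; congr image; apply/funext => t /=.
by rewrite add0r normr_ge0.
Qed.
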